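(* Assume the explicit abc conjecture: whenever $a,b,c$ are pairwise coprime non-zero integers with $a+b=c$, one has $c<N(abc)^{7/4}$, where $N(x)=\prod_{p\mid x}p$ denotes the product of the distinct primes dividing $x$. Let $t\geq 3$ be an integer and let $c>0$ be a fixed positive integer. Consider tuples of integers $(a_1,\dots,a_t,n_1,n_2)$ with $a_1\geq a_2\geq\cdots\geq a_t\geq 2$, $n_1\geq n_2\geq 2$ and $a_l\neq n_j$ for all $l,j$, satisfying $$\prod_{l=1}^t a_l! = n_1!\,n_2!.$$ Such a solution is called trivial if there is a pair $(l,j)$ with $|a_l-n_j|=1$, and nontrivial otherwise. For $2\leq i\leq t$ let $\mathcal{N}(c)_i$ be the set of nontrivial solutions with $n_1>a_1$, $n_2>a_i$ and $k_2/k_1\leq c$, where $k_1=n_1-a_1$ and $k_2=n_2-a_i$. (For such solutions, with $m_1=a_1+1$, $m_2=a_i+1$ and $\Delta(m,k)=m(m+1)\cdots(m+k-1)$, the equation is equivalent to $\prod_{l\neq 1,i}a_l!=\Delta(m_1,k_1)\Delta(m_2,k_2)$.) Then for every $2\leq i\leq t$ the set $\mathcal{N}(c)_i$ is finite. Consequently, the set $\mathcal{N}(c)=\bigcup_{i=2}^t\mathcal{N}(c)_i$ is finite, i.e. the equation $\prod_{l=1}^t a_l!=n_1!n_2!$ has only finitely many solutions in $\mathcal{N}(c)$.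
   Context: $N(x)$ denotes the algebraic radical of a non-zero integer $x$, i.e. the product of the distinct primes dividing $x$. The ''explicit abc conjecture'' is the hypothesis stated at the beginning of the claim. *)

(* Defs.v *)
From Stdlib Require Import Reals ZArith.
From mathcomp Require Import all_boot all_order all_algebra.
Set Implicit Arguments. Unset Strict Implicit. Unset Printing Implicit Defensive.
Import Order.TTheory GRing.Theory Num.Theory.

(* Algebraic radical of a natural number: product of its distinct prime divisors
   (rad 0 = 1 by convention; only used on non-zero arguments). *)
Definition rad (n : nat) : nat := (\prod_(p <- primes n) p)%N.

Definition radZ (x : Z) : Z := Z.of_nat (rad (Z.abs_nat x)).

Definition explicit_abc : Prop :=
  forall a b c : Z,
    a <> Z0 -> b <> Z0 -> c <> Z0 ->
    Z.gcd a b = Z.pos xH -> Z.gcd a c = Z.pos xH -> Z.gcd b c = Z.pos xH ->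
    Z.add a b = c ->
    Rlt (IZR c) (Rpower (IZR (radZ (Z.mul (Z.mul a b) c))) (Rdiv (INR 7) (INR 4))).

(* A tuple (a_1,...,a_t,n_1,n_2) is represented by (a, n1, n2) with
   a = [:: a_1; ...; a_t] : seq nat, so a_l = nth 0 a (l-1) (0-based below). *)
Definition solution (t : nat) (a : seq nat) (n1 n2 : nat) : bool :=
  [&& size a == t,
      sorted geq a,
      all (fun x => 2 <= x) a,
      n2 <= n1, 2 <= n2,
      all (fun x => (x != n1) && (x != n2)) a
    & (\prod_(x <- a) x`!) == n1`! * n2`!]%N.

Definition dist1 (x n : nat) : bool := (x.+1 == n) || (n.+1 == x).

Definition nontrivial (a : seq nat) (n1 n2 : nat) : bool :=
  all (fun x => ~~ dist1 x n1 && ~~ dist1 x n2) a.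

(* N(c)_i, with i given 0-based (paper's index i+1), 1 <= i <= t-1:
   k1 = n1 - a_1, k2 = n2 - a_{i+1}, condition k2 / k1 <= c. *)
Definition Nc_i (t c i : nat) (a : seq nat) (n1 n2 : nat) : Prop :=
  solution t a n1 n2 /\ nontrivial a n1 n2 /\
  (nth 0 a 0 < n1)%N /\ (nth 0 a i < n2)%N /\
  ((((n2 - nth 0 a i)%N)%:Q / ((n1 - nth 0 a 0)%N)%:Q) <= c%:Q)%R.

Definition finite_sols (P : seq nat -> nat -> nat -> Prop) : Prop :=
  exists L : seq (seq nat * nat * nat),
    forall a n1 n2, P a n1 n2 -> (a, n1, n2) \in L.

(* Main.v *)
From Stdlib Require Import Reals ZArith.
From mathcomp Require Import all_boot all_order all_algebra zify.
(* Required last: all_algebra has another constant named rad. *)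
Require Import Defs.
Set Implicit Arguments. Unset Strict Implicit. Unset Printing Implicit Defensive.

(** Put k_1 = n_1 - a_1 and k_2 = n_2 - a_i, so that k_2 <= c k_1, and let Q be
    the product of the factorials other than a_1! and a_i!; thus
    Q = (a_1 + 1)...n_1 * (a_i + 1)...n_2. By Legendre's formula at the prime 2
    the sum of all the a_j is at most n_1 + n_2 + T, where T = O(log n_1).

    A product of factorials whose arguments are at most x and add up to at most
    m + e is at most m! x^e. Applied to the a_j with j > 1 it gives
    (a_1 + 1)...n_1 <= a_1^(k_1 + T). For a fixed d this forces d k_1 <= a_1
    unless n_1 = O(log^2 n_1). Applied to the arguments of Q it gives
    a_1^k_1 k_2! <= (k_1 + k_2)! a_1^T, and hence k_1 = O(log^2 n_1) if
    d = 2^(c + 2).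

    The abc conjecture for 1 + x = x + 1 bounds the product of the radicals of
    a_1 + 1, ..., n_1 below by a fixed power of a_1^k_1. This product divides
    k_1! rad Q. As rad(x!) <= 8^x is smaller than any fixed power of x!, while
    Q <= n_1^((c + 1) k_1), this makes a_1 at most a constant times k_1^14,
    that is, at most a power of log n_1. *)

Lemma leq_wexp2r m n e : m <= n -> m ^ e <= n ^ e.
Proof. by case: e => // e; rewrite leq_exp2r. Qed.

Lemma leq_exp_root C m n e :
  0 < C -> 0 < e -> m ^ e <= C * n ^ e -> m <= C * n.
Proof.
move=> C_gt0 e_gt0 mn; rewrite -(leq_exp2r _ _ e_gt0) expnMn.
by rewrite (leq_trans mn) // leq_mul2r -{1}[C]expn1 leq_pexp2l ?orbT.
Qed.

Lemma bernoulli_expn x m : x ^ m * (x + m) <= x.+1 ^ m * x.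
Proof. by elim: m => [|m IHm]; [rewrite addn0 | rewrite !expnS; nia]. Qed.

Lemma poly_leq_exp2 C d : exists B, forall n, B <= n -> C * n ^ d <= 2 ^ n.
Proof.
exists (d.+1 * (d.+1 ^ d * C)) => n B_le_n.
set m := n %/ d.+1.
have n_lt : n <= m.+1 * d.+1 by rewrite ltnW // ltn_ceil.
have C_le : d.+1 ^ d * C <= m by rewrite leq_divRL // mulnC.
have poly_le : C * n ^ d <= m.+1 ^ d.+1.
  apply: (@leq_trans (C * (m.+1 ^ d * d.+1 ^ d))).
    by rewrite -expnMn leq_mul2l leq_wexp2r ?orbT.
  by rewrite mulnCA expnSr leq_mul2l mulnC (leqW C_le) orbT.
apply: leq_trans poly_le _; apply: (@leq_trans (2 ^ (m * d.+1))).
  by rewrite expnM leq_exp2r // ltn_expl.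
by rewrite leq_exp2l // leq_divM.
Qed.

Lemma polylog_bounded C d :
  exists B, forall n, n <= C * (trunc_log 2 n).+1 ^ d -> n <= B.
Proof.
have [L0 exp_ge] := poly_leq_exp2 (2 * C + 1) d.
exists (2 ^ L0) => n; set L := (trunc_log 2 n).+1 => n_le.
rewrite leqNgt; apply/negP => n_gt.
have n_gt0 : 0 < n by apply: leq_ltn_trans n_gt.
have L_gt : L0 < L.
  by rewrite -(ltn_exp2l _ _ (isT : 1 < 2)) (ltn_trans n_gt) // trunc_log_ltn.
have exp_le : 2 ^ L <= 2 * n by rewrite expnS leq_mul2l trunc_logP.
have := exp_ge L (ltnW L_gt); have : 0 < L ^ d by rewrite expn_gt0.
by nia.
Qed.

Lemma bin_leq_exp2 n m : 'C(n, m) <= 2 ^ n.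
Proof.
have [mn|mn] := ltnP m n.+1; last by rewrite bin_small.
rewrite -[2]/(1 + 1) expnDn (bigD1 (Ordinal mn)) //= !exp1n !muln1.
exact: leq_addr.
Qed.

Lemma fact_add_leq m n : (m + n)`! <= 2 ^ (m + n) * (m`! * n`!).
Proof.
have := bin_fact (leq_addr n m); rewrite addKn => <-.
by rewrite leq_mul2r bin_leq_exp2 orbT.
Qed.

Lemma exp_leq_fact a n : 0 < a -> a ^ n <= a ^ a * n`!.
Proof.
move=> a_gt0; elim: n => [|n IHn]; first by rewrite muln1 expn_gt0 a_gt0.
have [na|na] := leqP n.+1 a.
  by rewrite (leq_trans (leq_pexp2l a_gt0 na)) // leq_pmulr // fact_gt0.
by rewrite expnS factS mulnCA leq_mul // ltnW.
Qed.

Lemma fact_add m k : (m + k)`! = m`! * (m + k) ^_ k.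
Proof. by rewrite -(ffact_fact (leq_addl m k)) addnK mulnC. Qed.

Lemma ffact_prod_nat m k :
  (m + k) ^_ k = \prod_(m.+1 <= i < (m + k).+1) i.
Proof.
apply/eqP; rewrite -(eqn_pmul2l (fact_gt0 m)) -fact_add.
by rewrite (fact_split (leq_addr k m)).
Qed.

Lemma ffact_leq_exp n k : n ^_ k <= n ^ k.
Proof.
rewrite ffact_prod -[k in _ ^ k]card_ord -prod_nat_const.
by apply: leq_prod => i _; rewrite leq_subr.
Qed.

Lemma fact_leq_exp n : n`! <= n ^ n.
Proof. by rewrite -ffactnn ffact_leq_exp. Qed.

Lemma exp_leq_ffact m k : m ^ k <= (m + k) ^_ k.
Proof.
rewrite ffact_prod -[k in _ ^ k]card_ord -prod_nat_const.
by apply: leq_prod => i _; have := ltn_ord i; lia.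
Qed.

Lemma fact_leq_ffact m k : k`! <= (m + k) ^_ k.
Proof. by rewrite -bin_ffact leq_pmull // bin_gt0 leq_addl. Qed.

(* Pair the factor m + k - i with the factor m + 1 + i. *)
Lemma exp_leq_ffact_sq m k : (m * (m + k)) ^ k <= ((m + k) ^_ k) ^ 2.
Proof.
rewrite -mulnn {2}ffact_prod (reindex_inj rev_ord_inj) ffact_prod -big_split /=.
rewrite -[k in _ ^ k]card_ord -prod_nat_const.
apply: leq_prod => i _.
have i_lt := ltn_ord i.
have -> : m + k - (k - i.+1) = m + i.+1 by lia.
have -> : m + k - i = m + (k - i) by lia.
have : k = k - i + i by lia.
by nia.
Qed.

Lemma prod_fact_gt0 (s : seq nat) : 0 < \prod_(x <- s) x`!.
Proof. by rewrite prodn_gt0 // => x; exact: fact_gt0. Qed.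

(* Multiply out the factorials one after the other: the i-th factor written
   down is at most i, and at most a. *)
Lemma prod_fact_leq_prod_minn a (s : seq nat) : all (fun x => x <= a) s ->
  \prod_(x <- s) x`! <= \prod_(i < \sum_(x <- s) x) minn a i.+1.
Proof.
elim: s => [|x s IHs] /=; first by rewrite !big_nil big_ord0.
case/andP=> xa /IHs{}IHs.
rewrite !big_cons mulnC [x + _]addnC big_split_ord leq_mul //=.
rewrite fact_prod big_add1 big_mkord; apply: leq_prod => i _.
by rewrite leq_min (leq_trans (ltn_ord i) xa) ltnS leq_addl.
Qed.

Lemma prod_fact_leq a m e (s : seq nat) : 0 < a ->
  all (fun x => x <= a) s -> \sum_(x <- s) x <= m + e ->
  \prod_(x <- s) x`! <= m`! * a ^ e.
Proof.
move=> a_gt0 /prod_fact_leq_prod_minn le_minn sum_le.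
apply: leq_trans le_minn _.
apply: (@leq_trans (\prod_(i < m + e) minn a i.+1)).
  rewrite -(subnKC sum_le) big_split_ord leq_pmulr // prodn_gt0 // => i.
  by rewrite leq_min a_gt0.
rewrite big_split_ord leq_mul //=.
  by rewrite fact_prod big_add1 big_mkord; apply: leq_prod => i _; exact: geq_minr.
rewrite -[e in _ ^ e]card_ord -prod_nat_const.
by apply: leq_prod => i _; exact: geq_minl.
Qed.

Lemma logn_prod p (I : Type) (r : seq I) (P : pred I) (F : I -> nat) :
  (forall i, P i -> 0 < F i) ->
  logn p (\prod_(i <- r | P i) F i) = \sum_(i <- r | P i) logn p (F i).
Proof.
move=> F_gt0; elim: r => [|i r IHr]; first by rewrite !big_nil logn1.
rewrite !big_cons; case: ifP => // Pi.
by rewrite lognM ?F_gt0 ?prodn_cond_gt0 // IHr.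
Qed.

Lemma dvdn_from_log m n : 0 < m -> 0 < n ->
  (forall p, prime p -> logn p m <= logn p n) -> m %| n.
Proof.
move=> m_gt0 n_gt0 le_log; apply/dvdn_partP => // p.
by rewrite mem_primes => /andP[p_prime _]; rewrite p_part pfactor_dvdn // le_log.
Qed.

Lemma logn_fact_div p n : prime p -> logn p n`! = n %/ p + logn p (n %/ p)`!.
Proof.
move=> p_prime; have p_gt0 := prime_gt0 p_prime.
elim: n => [|n IHn]; first by rewrite div0n logn1.
rewrite factS lognM ?fact_gt0 // IHn lognE p_prime divnS //=.
case: (p %| n.+1) => //=; rewrite add1n factS lognM ?fact_gt0 //.
by rewrite !addSn addnCA.
Qed.

Lemma logn_fact_leq p n : prime p -> p.-1 * logn p n`! <= n.
Proof.
move=> p_prime; elim/ltn_ind: n => -[|n] IHn; first by rewrite logn1 muln0.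
have lt_n : n.+1 %/ p < n.+1 by rewrite ltn_Pdiv // prime_gt1.
rewrite logn_fact_div // mulnDr.
have := IHn _ lt_n; have := leq_divM n.+1 p; have := prime_gt0 p_prime.
by nia.
Qed.

Lemma leq_logn_fact p L n :
  prime p -> n < p ^ L -> n <= p.-1 * (logn p n`! + L).
Proof.
move=> p_prime; have p_gt0 := prime_gt0 p_prime.
elim: L n => [|L IHL] n; first by rewrite expn0; case: n.
rewrite expnSr -ltn_divLR // => /IHL; have := ltn_ceil n p_gt0.
by rewrite (logn_fact_div n p_prime); nia.
Qed.

Lemma sum_leq_logn_prod_fact p L (s : seq nat) :
  prime p -> all (fun x => x < p ^ L) s ->
  \sum_(x <- s) x <= p.-1 * (logn p (\prod_(x <- s) x`!) + size s * L).
Proof.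
move=> p_prime; elim: s => [|x s IHs]; first by rewrite !big_nil.
move=> /andP[/(leq_logn_fact p_prime) x_le /IHs s_le].
rewrite !big_cons lognM ?fact_gt0 ?prod_fact_gt0 //= mulSn addnACA mulnDr.
exact: leq_add.
Qed.

Lemma rad_gt0 n : 0 < rad n.
Proof.
rewrite /rad big_seq prodn_cond_gt0 // => p.
by rewrite mem_primes => /andP[/prime_gt0].
Qed.

Lemma logn_rad p n : logn p (rad n) = (p \in primes n).
Proof.
have primes_n q : q \in primes n -> prime q by rewrite mem_primes => /andP[].
rewrite /rad big_seq logn_prod; last by move=> q /primes_n/prime_gt0.
rewrite (eq_bigr (fun q => if q == p then 1 else 0)); last first.
  by move=> q /primes_n q_prime; rewrite logn_prime // eq_sym; case: eqP.
by rewrite -big_seq -big_mkcond sum1_count count_uniq_mem ?primes_uniq.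
Qed.

Lemma rad_dvdn m n : 0 < n -> {subset primes m <= primes n} -> rad m %| n.
Proof.
move=> n_gt0 sub_mn; apply: dvdn_from_log => // [|p _]; first exact: rad_gt0.
rewrite logn_rad; case: (boolP (p \in primes m)) => [/sub_mn|//].
by rewrite -logn_gt0.
Qed.

Lemma mem_primes_rad p n : (p \in primes (rad n)) = (p \in primes n).
Proof. by rewrite -logn_gt0 logn_rad lt0b. Qed.

Lemma leq_rad m n : {subset primes m <= primes n} -> rad m <= rad n.
Proof.
move=> sub_mn; apply: dvdn_leq (rad_gt0 n) (rad_dvdn (rad_gt0 n) _) => p.
by rewrite mem_primes_rad; apply: sub_mn.
Qed.

Lemma dvdn_leq_rad m n : 0 < n -> m %| n -> rad m <= rad n.
Proof. by move=> n_gt0 m_dvd; apply: leq_rad; apply: pi_of_dvd. Qed.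

Lemma rad_leq n : 0 < n -> rad n <= n.
Proof. by move=> n_gt0; apply: dvdn_leq (rad_dvdn _ _). Qed.

Lemma radM_leq m n : 0 < m -> 0 < n -> rad (m * n) <= rad m * rad n.
Proof.
move=> m_gt0 n_gt0; have rad_mn_gt0 : 0 < rad m * rad n by rewrite muln_gt0 !rad_gt0.
apply: dvdn_leq rad_mn_gt0 (rad_dvdn rad_mn_gt0 _) => p.
by rewrite !primesM ?rad_gt0 // !mem_primes_rad.
Qed.

(* A prime p <= n divides 'C(n, n./2), unless p <= uphalf n. *)
Lemma rad_fact_uphalf_leq n : rad n`! <= 2 ^ n * rad (uphalf n)`!.
Proof.
have half_le : n./2 <= n by lia.
have sub_half : n - n./2 = uphalf n by lia.
have fact_dvd : (n./2)`! %| (uphalf n)`!.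
  by rewrite (@fact_split (uphalf n) n./2) ?dvdn_mulr //; lia.
have C_gt0 : 0 < 'C(n, n./2) by rewrite bin_gt0.
apply: (@leq_trans (rad ('C(n, n./2) * (uphalf n)`!))).
  apply: leq_rad => p; rewrite -(bin_fact half_le) sub_half.
  rewrite !primesM ?muln_gt0 ?fact_gt0 //.
  have sub_primes := pi_of_dvd fact_dvd (fact_gt0 _).
  by case/or3P=> [->|/sub_primes ->|->]; rewrite ?orbT.
apply: leq_trans (radM_leq C_gt0 (fact_gt0 _)) _.
by rewrite leq_mul2r (leq_trans (rad_leq C_gt0)) ?bin_leq_exp2 ?orbT.
Qed.

Lemma rad_fact_leq n : rad n`! <= 8 ^ n.
Proof.
elim/ltn_ind: n => -[|[|[|n]]] IHn; try by rewrite /rad unlock.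
have uphalf_lt : uphalf n.+3 < n.+3 by lia.
apply: leq_trans (rad_fact_uphalf_leq _) _.
apply: (@leq_trans (2 ^ n.+3 * 8 ^ uphalf n.+3)).
  by rewrite leq_mul2l IHn ?orbT.
rewrite -[8]/(2 ^ 3) -!expnM -expnD leq_exp2l //.
by lia.
Qed.

(* The constant in exp_leq_fact at a = 8 ^ q, as rad n`! <= 8 ^ n. *)
Definition rad_fact_coef q := (8 ^ q) ^ (8 ^ q).

Lemma rad_fact_coef_gt0 q : 0 < rad_fact_coef q.
Proof. by rewrite !expn_gt0. Qed.

Lemma rad_prod_fact_leq q (s : seq nat) :
  rad (\prod_(x <- s) x`!) ^ q <= rad_fact_coef q ^ size s * \prod_(x <- s) x`!.
Proof.
elim: s => [|x s IHs]; first by rewrite big_nil /rad big_nil exp1n.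
rewrite !big_cons /= expnS mulnACA.
have rad_x_le : rad x`! ^ q <= rad_fact_coef q * x`!.
  apply: leq_trans (exp_leq_fact x (_ : 0 < 8 ^ q)); last by rewrite expn_gt0.
  by rewrite -expnM mulnC expnM leq_wexp2r // rad_fact_leq.
apply: leq_trans (leq_mul rad_x_le IHs).
by rewrite -expnMn leq_wexp2r // radM_leq ?fact_gt0 ?prod_fact_gt0.
Qed.

Lemma sum_dvdn_leq d m k :
  \sum_(m.+1 <= i < (m + k).+1) (d %| i) <= k %/ d + 1.
Proof.
rewrite -(leq_add2l (m %/ d)) addnA; apply: leq_trans (leq_divDl d m k).
by rewrite !divn_count_dvd -big_cat_nat //= ltnS leq_addr.
Qed.

(* A prime p divides at most k %/ p + 1 of the k factors, and
   k %/ p <= logn p k`!. *)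
Lemma prod_rad_dvdn m k :
  \prod_(m.+1 <= i < (m + k).+1) rad i %| k`! * rad ((m + k) ^_ k).
Proof.
apply: dvdn_from_log => [||p p_prime].
- by rewrite prodn_gt0 // => i; exact: rad_gt0.
- by rewrite muln_gt0 fact_gt0 rad_gt0.
rewrite logn_prod => [|i _]; last exact: rad_gt0.
rewrite lognM ?fact_gt0 ?rad_gt0 // logn_rad ffact_prod_nat.
rewrite (eq_bigr (fun i => nat_of_bool (p \in primes i))) => [|i _]; last first.
  exact: logn_rad.
have [p_prod|p_prod] := boolP (p \in primes _).
  apply: (@leq_trans (\sum_(m.+1 <= i < (m + k).+1) (p %| i))).
    apply: leq_sum => i _; rewrite mem_primes.
    by case: (p %| i); rewrite ?andbF ?leq_b1.
  apply: leq_trans (sum_dvdn_leq p m k) _.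
  by rewrite leq_add2r logn_fact_div // leq_addr.
rewrite big_nat big1 // => i i_range; apply/eqP; rewrite eqb0.
apply: contra p_prod; apply: pi_of_dvd.
  by rewrite (big_rem i) ?mem_index_iota //= dvdn_mulr.
by rewrite -ffact_prod_nat ffact_gt0 leq_addl.
Qed.

Lemma INR_expn m n : INR (m ^ n) = pow (INR m) n.
Proof. by elim: n => [|n IHn] //=; rewrite expnS -multE mult_INR IHn. Qed.

Lemma lt_Rpower_leq_expn m r p q : 0 < r -> 0 < q ->
  Rlt (INR m) (Rpower (INR r) (Rdiv (INR p) (INR q))) -> m ^ q <= r ^ p.
Proof.
move=> r_gt0 q_gt0 lt_m; apply/leP/INR_le; rewrite !INR_expn.
have INR_r_gt0 : Rlt 0 (INR r) by apply: (lt_INR 0); apply/ltP.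
have -> : pow (INR r) p = pow (Rpower (INR r) (Rdiv (INR p) (INR q))) q.
  rewrite -[in RHS]Rpower_pow; last exact: exp_pos.
  rewrite Rpower_mult -Rpower_pow // /Rdiv Rmult_assoc Rinv_l ?Rmult_1_r //.
  by apply: not_0_INR; lia.
by apply: pow_incr; split; [exact: pos_INR | exact: Rlt_le].
Qed.

Lemma abc_coprime a b : explicit_abc -> 0 < a -> 0 < b -> coprime a b ->
  (a + b) ^ 4 <= rad (a * b * (a + b)) ^ 7.
Proof.
move=> abc a_gt0 b_gt0 /eqP cop_ab; apply: lt_Rpower_leq_expn => //.
  exact: rad_gt0.
have := abc (Z.of_nat a) (Z.of_nat b) (Z.of_nat (a + b)).
rewrite /radZ -!INR_IZR_INZ.
rewrite (_ : Z.abs_nat _ = a * b * (a + b)); last by lia.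
have gcd_abs m n : Z.gcd (Z.of_nat m) (Z.of_nat n) = Z.of_nat (gcdn m n) by lia.
apply; rewrite ?gcd_abs; try lia.
- by rewrite gcdnDl cop_ab.
- by rewrite gcdnDr gcdnC cop_ab.
Qed.

Lemma abc_consecutive x : explicit_abc -> 0 < x ->
  x.+1 ^ 4 <= (rad x * rad x.+1) ^ 7.
Proof.
move=> abc x_gt0; have := abc_coprime abc (isT : 0 < 1) x_gt0 (coprime1n x).
by rewrite mul1n add1n => /leq_trans; apply; rewrite leq_wexp2r // radM_leq.
Qed.

(* Apply abc to each pair of neighbours; every radical occurs in at most two
   pairs. *)
Lemma abc_prod_rad m k : explicit_abc ->
  m ^ (4 * k) <= (\prod_(m.+1 <= i < (m + k.+1).+1) rad i) ^ 14.
Proof.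
move=> abc; set P := \prod_(_ <= i < _) _.
have P_gt0 : 0 < P by rewrite prodn_gt0 // => i; exact: rad_gt0.
have range_le : m.+1 <= (m + k).+1 by rewrite ltnS leq_addr.
have pairs_le : \prod_(m.+1 <= i < (m + k).+1) (rad i * rad i.+1) <= P ^ 2.
  rewrite big_split -mulnn leq_mul //= /P addnS.
    by rewrite [X in _ <= X]big_nat_recr // leq_pmulr ?rad_gt0.
  by rewrite [X in _ <= X]big_nat_recl // leq_pmull ?rad_gt0.
rewrite (expnM P 2 7); apply: leq_trans (leq_wexp2r 7 pairs_le).
elim: k {P P_gt0 range_le pairs_le} => [|k IHk].
  by rewrite addn0 big_geq // muln0 exp1n.
rewrite addnS big_nat_recr /=; last by rewrite ltnS leq_addr.
rewrite expnMn mulnSr expnD leq_mul //.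
apply: leq_trans (abc_consecutive abc _) => //.
by rewrite leq_exp2r //; lia.
Qed.

Lemma abc_ffact m k : explicit_abc -> 0 < m -> 1 < k ->
  m ^ (2 * k) <= (k`! * rad ((m + k) ^_ k)) ^ 14.
Proof.
move=> abc m_gt0 k_gt1; apply: (@leq_trans (m ^ (4 * k.-1))).
  by rewrite leq_pexp2l //; lia.
apply: leq_trans (abc_prod_rad m k.-1 abc) _; rewrite prednK ?(ltnW k_gt1) //.
apply: leq_wexp2r; apply: dvdn_leq (prod_rad_dvdn m k).
by rewrite muln_gt0 fact_gt0 rad_gt0.
Qed.

Lemma mul_ffact_leq_exp m k n l c :
  0 < m -> k <= m -> n + l <= m + k -> l <= c * k ->
  (m + k) ^_ k * (n + l) ^_ l <= (2 * m) ^ (k * c.+1).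
Proof.
move=> m_gt0 k_le add_le l_le.
apply: (@leq_trans ((m + k) ^ k * (m + k) ^ l)).
  rewrite leq_mul ?ffact_leq_exp //.
  by apply: leq_trans (ffact_leq_exp _ _) (leq_wexp2r _ add_le).
rewrite -expnD; apply: (@leq_trans ((m + k) ^ (k * c.+1))).
  by rewrite leq_pexp2l ?addn_gt0 ?m_gt0 // mulnS leq_add2l mulnC.
by rewrite leq_wexp2r // mul2n -addnn leq_add2l.
Qed.

Lemma abc_gap_bound m k n l c (s : seq nat) : explicit_abc ->
  1 < k -> k <= m -> n + l <= m + k -> l <= c * k ->
  \prod_(x <- s) x`! = (m + k) ^_ k * (n + l) ^_ l ->
  m <= rad_fact_coef (14 * c.+1) ^ size s * (2 * k ^ 14).
Proof.
move=> abc k_gt1 k_le add_le l_le prod_eq.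
have k_gt0 := ltnW k_gt1; have m_gt0 := leq_trans k_gt0 k_le.
set C := rad_fact_coef _ ^ _; set e := k * c.+1.
set R := rad (\prod_(x <- s) x`!).
have C_gt0 : 0 < C by rewrite expn_gt0 rad_fact_coef_gt0.
have rad_pow_le : R ^ (14 * c.+1) <= C * (2 ^ e * m ^ e).
  apply: leq_trans (rad_prod_fact_leq _ s) _; rewrite leq_mul2l -expnMn prod_eq.
  by rewrite mul_ffact_leq_exp ?orbT.
have abc_le : m ^ (2 * k) <= k`! ^ 14 * R ^ 14.
  apply: leq_trans (abc_ffact abc m_gt0 k_gt1) _.
  rewrite -expnMn leq_wexp2r // leq_mul2l dvdn_leq_rad ?prod_fact_gt0 ?orbT //.
  by rewrite prod_eq dvdn_mulr.
have fact_le : (k`! ^ 14) ^ c.+1 <= (k ^ 14) ^ e.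
  rewrite /e [(k ^ 14) ^ _]expnM -(expnM k 14 k) mulnC expnM.
  by rewrite !leq_wexp2r // fact_leq_exp.
apply: (@leq_exp_root C _ _ e) => //; first by rewrite muln_gt0 k_gt0.
have me_gt0 : 0 < m ^ e by rewrite expn_gt0 m_gt0.
rewrite -(leq_pmul2l me_gt0); apply: (@leq_trans ((m ^ (2 * k)) ^ c.+1)).
  by rewrite -expnD -expnM leq_pexp2l // /e; lia.
apply: leq_trans (leq_wexp2r c.+1 abc_le) _; rewrite expnMn -(expnM R).
apply: leq_trans (leq_mul fact_le rad_pow_le) _.
by rewrite expnMn; lia.
Qed.

(* 1 + k / m >= 1 + 1 / d, and (1 + 1 / d) ^ d >= 2. *)
Lemma exp2_leq_ratio m k d r : 0 < m -> 0 < d -> m <= k * d ->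
  (m + k) ^ k <= m ^ k * r -> 2 ^ k <= r ^ d.
Proof.
move=> m_gt0 d_gt0 m_le ratio_le.
have succ_le : d.+1 ^ k <= d ^ k * r.
  have mk_gt0 : 0 < m ^ k by rewrite expn_gt0 m_gt0.
  rewrite -(leq_pmul2l mk_gt0) mulnCA.
  apply: leq_trans (leq_mul (leqnn _) ratio_le).
  by rewrite -!expnMn leq_wexp2r //; nia.
have double_le : 2 * d ^ d <= d.+1 ^ d.
  rewrite -(leq_pmul2r d_gt0); apply: leq_trans (bernoulli_expn d d).
  by rewrite addnn -mul2n mulnCA mulnA.
have dk_gt0 : 0 < (d ^ d) ^ k by rewrite !expn_gt0 d_gt0.
rewrite -(leq_pmul2r dk_gt0) -expnMn.
apply: leq_trans (leq_wexp2r k double_le) _.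
rewrite -!expnM [d * k]mulnC !expnM mulnC -expnMn.
exact: leq_wexp2r.
Qed.

Section FactorialEquation.

Variables (a1 ai k1 k2 : nat) (s : seq nat).
Hypothesis a1_gt0 : 0 < a1.
Hypothesis leq_a1 : all (fun x => x <= a1) (ai :: s).
Hypothesis fact_eq :
  a1`! * (ai`! * \prod_(x <- s) x`!) = (a1 + k1)`! * (ai + k2)`!.

Local Notation bits := (trunc_log 2 (a1 + k1)).+1.
Local Notation slack := ((size s).+2 * bits).

Lemma prod_fact_eq_ffact :
  \prod_(x <- s) x`! = (a1 + k1) ^_ k1 * (ai + k2) ^_ k2.
Proof.
apply/eqP; rewrite -(eqn_pmul2l (fact_gt0 ai)) -(eqn_pmul2l (fact_gt0 a1)) fact_eq.
by rewrite !fact_add -!mulnA [ai`! * (_ * _)]mulnCA.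
Qed.

Lemma ltn_exp2_bits x : x <= a1 -> x < 2 ^ bits.
Proof.
move=> x_le; apply: (@leq_ltn_trans (a1 + k1)); last exact: trunc_log_ltn.
exact: leq_trans x_le (leq_addr _ _).
Qed.

Lemma sum_leq_add_slack : ai + \sum_(x <- s) x <= ai + k2 + (k1 + slack).
Proof.
have lt_bits : all (fun x => x < 2 ^ bits) [:: a1, ai & s].
  rewrite /= ltn_exp2_bits //; apply: sub_all leq_a1 => x; exact: ltn_exp2_bits.
have := sum_leq_logn_prod_fact (isT : prime 2) lt_bits.
rewrite !big_cons fact_eq lognM ?fact_gt0 // mul1n.
have := logn_fact_leq (a1 + k1) (isT : prime 2).
have := logn_fact_leq (ai + k2) (isT : prime 2).
by rewrite !mul1n /=; lia.
Qed.

Lemma ffact_leq_exp_add_slack : (a1 + k1) ^_ k1 <= a1 ^ (k1 + slack).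
Proof.
rewrite -(leq_pmul2l (fact_gt0 (ai + k2))).
have sum_le : \sum_(x <- ai :: s) x <= ai + k2 + (k1 + slack).
  by rewrite big_cons sum_leq_add_slack.
apply: leq_trans (prod_fact_leq a1_gt0 leq_a1 sum_le).
by rewrite big_cons prod_fact_eq_ffact fact_add mulnCA mulnC mulnA.
Qed.

Lemma exp2_leq_exp_bits m e : 2 ^ m <= a1 ^ e -> m <= bits * e.
Proof.
move=> exp_le; rewrite -(leq_exp2l _ _ (isT : 1 < 2)) expnM.
by apply: leq_trans exp_le (leq_wexp2r _ (ltnW _)); exact: ltn_exp2_bits.
Qed.

Lemma wide_gap_bound d : 0 < d -> a1 <= k1 * d ->
  a1 + k1 <= 2 * (size s).+2 * d * d.+1 * bits ^ 2.
Proof.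
move=> d_gt0 a1_le.
have k1_le : k1 <= bits * (2 * slack * d).
  apply: exp2_leq_exp_bits; rewrite expnM.
  apply: (exp2_leq_ratio a1_gt0 d_gt0 a1_le).
  have exp_gt0 : 0 < a1 ^ k1 by rewrite expn_gt0 a1_gt0.
  rewrite -(leq_pmul2l exp_gt0) -expnMn.
  apply: leq_trans (exp_leq_ffact_sq a1 k1) _.
  apply: leq_trans (leq_wexp2r 2 ffact_leq_exp_add_slack) _.
  by rewrite -expnM -!expnD leq_pexp2l //; lia.
apply: (@leq_trans (k1 * d.+1)); first by rewrite mulnS addnC leq_add2l.
by apply: leq_trans (leq_mul k1_le (leqnn _)) _; rewrite -mulnn; lia.
Qed.

Lemma narrow_gap_bound c :
  0 < k1 -> k2 <= c * k1 -> k1 * 2 ^ c.+2 <= a1 -> k1 <= bits * slack.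
Proof.
move=> k1_gt0 k2_le k1_le; apply: exp2_leq_exp_bits.
have sum_le : \sum_(x <- s) x <= k1 + k2 + slack.
  by have := sum_leq_add_slack; lia.
have /andP[_ s_leq_a1] := leq_a1.
have exp_fact_le : a1 ^ k1 * k2`! <= 2 ^ (k1 + k2) * (k1`! * k2`!) * a1 ^ slack.
  apply: (@leq_trans (\prod_(x <- s) x`!)).
    by rewrite prod_fact_eq_ffact leq_mul ?exp_leq_ffact ?fact_leq_ffact.
  apply: leq_trans (prod_fact_leq a1_gt0 s_leq_a1 sum_le) _.
  by rewrite leq_mul2r fact_add_leq orbT.
have exp_le : a1 ^ k1 <= 2 ^ (k1 + k2) * k1`! * a1 ^ slack.
  rewrite -(leq_pmul2r (fact_gt0 k2)); apply: leq_trans exp_fact_le _.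
  by rewrite mulnA mulnAC.
have factor_gt0 : 0 < k1 ^ k1 * 2 ^ (c.+1 * k1).
  by rewrite muln_gt0 !expn_gt0 k1_gt0.
rewrite -(leq_pmul2l factor_gt0); apply: (@leq_trans (a1 ^ k1)).
  by rewrite expnM -!expnMn leq_wexp2r // -mulnA -expnSr.
apply: leq_trans exp_le _; rewrite leq_mul2r [k1 ^ k1 * _]mulnC.
rewrite leq_mul ?orbT ?fact_leq_exp //.
by rewrite leq_exp2l // mulSn leq_add2l.
Qed.

Lemma narrow_gap_abc_bound c : explicit_abc ->
  1 < k1 -> ai + k2 <= a1 + k1 -> k2 <= c * k1 -> k1 * 2 ^ c.+2 <= a1 ->
  a1 + k1 <=
    2 * (rad_fact_coef (14 * c.+1) ^ size s * (2 * (size s).+2 ^ 14)) * bits ^ 28.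
Proof.
move=> abc k1_gt1 n2_le k2_le narrow.
have k1_le_a1 : k1 <= a1.
  by apply: leq_trans narrow; rewrite leq_pmulr // expn_gt0.
have a1_le := abc_gap_bound abc k1_gt1 k1_le_a1 n2_le k2_le prod_fact_eq_ffact.
have k1_pow_le : k1 ^ 14 <= (size s).+2 ^ 14 * bits ^ 28.
  rewrite (expnM _ 2 14) -expnMn leq_wexp2r // -mulnn mulnA mulnC.
  exact: narrow_gap_bound (ltnW k1_gt1) k2_le narrow.
apply: (@leq_trans (2 * a1)); first by rewrite mul2n -addnn leq_add2l.
rewrite -3!mulnA leq_mul2l; apply: leq_trans a1_le _.
by rewrite 2!leq_mul2l k1_pow_le !orbT.
Qed.

End FactorialEquation.

Lemma fact_gap_equation_bounded t c : explicit_abc ->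
  exists B, forall a1 ai k1 k2 (s : seq nat), size s = t -> 0 < a1 ->
    all (fun x => x <= a1) (ai :: s) -> ai + k2 <= a1 + k1 ->
    1 < k1 -> k2 <= c * k1 ->
    a1`! * (ai`! * \prod_(x <- s) x`!) = (a1 + k1)`! * (ai + k2)`! ->
    a1 + k1 <= B.
Proof.
move=> abc; set d := 2 ^ c.+2; have d_gt0 : 0 < d by rewrite expn_gt0.
set C_wide := 2 * t.+2 * d * d.+1.
set C_narrow := 2 * (rad_fact_coef (14 * c.+1) ^ t * (2 * t.+2 ^ 14)).
have [B B_bound] := polylog_bounded (C_wide + C_narrow) 28.
exists B => a1 ai k1 k2 s size_s a1_gt0 leq_a1 n2_le k1_gt1 k2_le fact_eq.
apply: B_bound; rewrite mulnDl; have [wide|/ltnW narrow] := leqP a1 (k1 * d).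
  have := wide_gap_bound a1_gt0 leq_a1 fact_eq d_gt0 wide.
  rewrite size_s => /leq_trans; apply; apply: leq_trans (leq_addr _ _).
  by rewrite leq_mul2l leq_pexp2l ?orbT.
have := narrow_gap_abc_bound a1_gt0 leq_a1 fact_eq abc k1_gt1 n2_le k2_le narrow.
by rewrite size_s => /leq_trans; apply; apply: leq_addl.
Qed.

Lemma all_leq_nth0 (a : seq nat) :
  sorted geq a -> all (fun x => x <= nth 0 a 0) a.
Proof.
case: a => [//|x a] /=; rewrite path_sortedE => [|y z u /=]; last by lia.
by rewrite leqnn => /andP[].
Qed.

Lemma perm_nth0_nth (T : eqType) (x0 : T) (a : seq T) i : 0 < i < size a ->
  exists s, perm_eq a [:: nth x0 a 0, nth x0 a i & s].
Proof.
case: a i => [|x a] [|i] //=; rewrite ltnS => lt_i.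
by exists (rem (nth x0 a i) a); rewrite perm_cons perm_to_rem // mem_nth.
Qed.

Lemma Nc_i_n1_bounded t c : explicit_abc ->
  exists B, forall i a n1 n2, 1 <= i < t -> Nc_i t c i a n1 n2 -> n1 <= B.
Proof.
move=> /(fact_gap_equation_bounded t.-2 c)[B B_bound]; exists B => i a n1 n2 i_range.
case=> /and5P[/eqP size_a sorted_a ge2_a n2_le /and3P[_ _ /eqP prod_eq]].
case=> nontriv [lt_n1 [lt_n2 ratio_le]].
have head_in : nth 0 a 0 \in a by rewrite mem_nth // size_a; lia.
have [s perm_a] : exists s, perm_eq a [:: nth 0 a 0, nth 0 a i & s].
  by apply: perm_nth0_nth; rewrite size_a.
move: (all_leq_nth0 sorted_a) (allP ge2_a _ head_in) (allP nontriv _ head_in) => /=.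
move: lt_n1 lt_n2 ratio_le (perm_size perm_a) prod_eq.
rewrite (perm_all _ perm_a) (perm_big _ perm_a) size_a !big_cons /dist1 /=.
move: (nth 0 a 0) (nth 0 a i) => a1 ai lt_n1 lt_n2 ratio_le size_s prod_eq.
case/andP=> _ leq_a1 a1_ge2 /andP[far_n1 _].
have gap_le : n2 - ai <= c * (n1 - a1).
  move: ratio_le; rewrite Num.Theory.ler_pdivrMr; last by rewrite ltr0z; lia.
  by rewrite -intrM ler_int; lia.
rewrite -(subnKC (ltnW lt_n1)).
apply: (B_bound a1 ai (n1 - a1) (n2 - ai) s) => //; try lia.
by rewrite !subnKC // ltnW.
Qed.

Lemma Nc_i_bounded t c : explicit_abc ->
  exists B, forall i a n1 n2, 1 <= i < t -> Nc_i t c i a n1 n2 ->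
    [/\ size a = t, all (fun x => x <= B) a, n1 <= B & n2 <= B].
Proof.
move=> /(Nc_i_n1_bounded t c)[B B_bound]; exists B => i a n1 n2 i_range Nc_a.
have n1_le := B_bound _ _ _ _ i_range Nc_a.
case: Nc_a => /and5P[/eqP size_a sorted_a _ n2_le _] [_ [lt_n1 _]].
split => //; last exact: leq_trans n2_le n1_le.
by apply: sub_all (all_leq_nth0 sorted_a) => x /leq_trans; apply; lia.
Qed.

Lemma finite_sols_bounded t B (P : seq nat -> nat -> nat -> Prop) :
  (forall a n1 n2, P a n1 n2 -> [/\ size a = t, all (fun x => x <= B) a,
     n1 <= B & n2 <= B]) -> finite_sols P.
Proof.
move=> P_bounded; exists [seq (map val (val u.1), val u.2.1, val u.2.2) |
  u : t.-tuple 'I_B.+1 * ('I_B.+1 * 'I_B.+1)] => a n1 n2.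
case/P_bounded=> size_a a_le n1_le n2_le.
have size_ord_a : size (map (@inord B) a) == t by rewrite size_map size_a.
apply/mapP; exists (Tuple size_ord_a, (inord n1, inord n2)); first exact: mem_enum.
rewrite /= !inordK //; congr (_, _, _).
by rewrite -map_comp map_id_in // => x /(allP a_le) x_le; rewrite /= inordK.
Qed.

Theorem theorem1p1 :
  explicit_abc ->
  forall t c : nat, (3 <= t)%N -> (0 < c)%N ->
    (forall i : nat, (1 <= i < t)%N -> finite_sols (Nc_i t c i)) /\
    finite_sols (fun a n1 n2 => exists2 i : nat, (1 <= i < t)%N & Nc_i t c i a n1 n2).
Proof.
move=> abc t c _ _; have [B Nc_bound] := Nc_i_bounded t c abc.
split=> [i i_range|]; apply: (@finite_sols_bounded t B) => a n1 n2.
  exact: Nc_bound.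
by case=> i; apply: Nc_bound.
Qed.
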